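(* For every integer $n\ge0$, $$\overline p(n)=(-1)^n\sum_{\substack{c\in\mathcal C_{P_4}\\ |c|=n}}(-2)^{\ell(c)},$$ where $P_4=\{m^2: m\in\mathbb N\}$ is the set of positive squares.
   Context: An overpartition of $n$ is a partition of $n$ in which the first occurrence of each distinct part may or may not be overlined; $\overline p(n)$ is the number of overpartitions of $n$ ($\overline p(0)=1$), so that $\sum_{n\ge0}\overline p(n)q^n=\prod_{j\ge1}\frac{1+q^j}{1-q^j}$. A composition is an ordered finite sequence of positive integers (including the empty one); $|c|$ is the sum and $\ell(c)$ the number of parts; $\mathcal C_T$ is the set of compositions with all parts in $T$. *)

(* Defs.v *)
From mathcomp Require Import all_boot all_order all_algebra.
Set Implicit Arguments. Unset Strict Implicit. Unset Printing Implicit Defensive.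
Import GRing.Theory Num.Theory.

(* An overpartition of n, represented canonically as a sequence of
   (part, overlined?) pairs whose parts are positive, listed in
   nonincreasing order, summing to n, where only the first occurrence of
   each distinct part may be overlined. *)
Definition is_overpartition (n : nat) (s : seq (nat * bool)) : bool :=
  [&& all (fun x => 0 < x.1) s,
      sorted geq (map fst s),
      sumn (map fst s) == n &
      all (fun i => (nth (0, false) s i).2 ==>
                    (index (nth (0, false) s i).1 (map fst s) == i))
          (iota 0 (size s))].

(* Every overpartition of n has at most n parts, each at most n, so it is
   enumerated by the tuples below. *)
Definition overpartition_count (n : nat) : nat :=
  \sum_(k < n.+1)
    #|[pred t : k.-tuple ('I_n.+1 * bool) |
        is_overpartition n (map (fun x => (nat_of_ord x.1, x.2)) t)]|.

Definition is_pos_square (m : nat) : bool :=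
  (0 < m) && [exists j : 'I_m.+1, (j * j)%N == m].

Definition is_sq_composition (n : nat) (c : seq nat) : bool :=
  all is_pos_square c && (sumn c == n).

(* Main.v *)
(* Everything happens in R[X] modulo X^(N+1).  Write E and D for the products of
   1 + X^j and of 1 - X^j over 1 <= j <= N, and theta for the truncation of the
   sum of (-1)^m X^(m^2) over all integers m.  Gauss's identity E * theta = D
   follows from an exact finite identity that telescopes.  The overpartition
   series P satisfies D * P = E, while the signed series C of compositions into
   squares is the geometric series inverting theta, because (-1)^(m^2) = (-1)^m.
   Hence E * P = E * P * theta * C = D * P * C = E * C, and E is cancellable. *)
Require Import Defs.
From mathcomp Require Import all_boot all_order all_algebra.
From mathcomp Require Import ring zify.
Import GRing.Theory Num.Theory.
Local Open Scope ring_scope.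
Set Implicit Arguments. Unset Strict Implicit. Unset Printing Implicit Defensive.

(** * Polynomials modulo a power of [X] *)

Section TruncatedSeries.
Context {R : comNzRingType}.
Implicit Types p q : {poly R}.

Definition eqmodX (n : nat) p q : Prop := exists r, p - q = r * 'X^n.

Lemma eqmodX_refl n p : eqmodX n p p.
Proof. by exists 0; rewrite subrr mul0r. Qed.

Lemma eqmodX_sym n p q : eqmodX n p q -> eqmodX n q p.
Proof. by case=> r e; exists (- r); rewrite mulNr -e opprB. Qed.

Lemma eqmodX_trans n p q r : eqmodX n p q -> eqmodX n q r -> eqmodX n p r.
Proof.
case=> u eu [v ev]; exists (u + v).
by rewrite mulrDl -eu -ev; ring.
Qed.

Lemma eqmodXM n p p' q q' :
  eqmodX n p p' -> eqmodX n q q' -> eqmodX n (p * q) (p' * q').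
Proof.
case=> u eu [v ev]; exists (u * q + p' * v).
have -> : p * q - p' * q' = (p - p') * q + p' * (q - q') by ring.
by rewrite eu ev; ring.
Qed.

Lemma eqmodXP n p q :
  eqmodX n p q <-> (forall i, (i < n)%N -> p`_i = q`_i).
Proof.
split=> [[r e] i lt_in | e].
  by apply/subr0_eq; rewrite -coefB e coefMXn lt_in.
exists (drop_poly n (p - q)).
rewrite -{1}[p - q](poly_take_drop n) (_ : take_poly n _ = 0) ?add0r //.
apply/polyP=> i; rewrite coef_take_poly coefB coef0.
by case: ifP => // /e ->; rewrite subrr.
Qed.

(** The finite geometric sum misses [1] by exactly [('X * p) ^+ n], a multiple of ['X^n]. *)
Lemma eqmodX_geometric n p :
  eqmodX n ((1 - 'X * p) * \sum_(k < n) ('X * p) ^+ k) 1.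
Proof.
exists (- p ^+ n).
have := subrX1 ('X * p) n; rewrite exprMn => e.
by rewrite -[1 - 'X * p]opprB mulNr -e; ring.
Qed.

(* p = 1 - X g is invertible modulo X^n by the geometric series. *)
Lemma eqmodX_cancel n p q r :
  p`_0 = 1 -> eqmodX n (p * q) (p * r) -> eqmodX n q r.
Proof.
move=> p0 epq.
have [g ep] : exists g, p = 1 - 'X * g.
  exists (- drop_poly 1 p); rewrite -{1}[p](poly_take_drop 1).
  suff -> : take_poly 1 p = 1 by ring.
  apply/polyP=> i; rewrite coef_take_poly coef1.
  by case: i => [|i] //=.
have inv := eqmodX_geometric n g; rewrite -ep in inv.
set h := (X in p * X) in inv.
have cancel s : eqmodX n (h * (p * s)) s.
  rewrite mulrA [h * p]mulrC -[X in eqmodX _ _ X]mul1r.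
  exact: eqmodXM inv (eqmodX_refl n s).
apply: eqmodX_trans (cancel r).
apply: eqmodX_trans (eqmodX_sym (cancel q)) _.
exact: eqmodXM (eqmodX_refl n h) epq.
Qed.

End TruncatedSeries.

(** * Gauss's square identity in finite form *)

Section Gauss.
Context {R : comNzRingType}.
Local Notation poly := {poly R}.

Definition qpoch n : poly := \prod_(j < n) (1 - 'X^(j.+1)).
Definition qpoch_plus n : poly := \prod_(j < n) (1 + 'X^(j.+1)).
Definition theta n : poly := 1 + \sum_(j < n) (-1) ^+ j.+1 * 'X^(j.+1 ^ 2) *+ 2.

(* A Shanks-type identity: only the term s = 0 survives modulo X^(n+1).  The
   summand s is (-1)^s (-1; X)_s times the quotient (X; X)_n / (X; X)_s. *)
Lemma theta_mul_qpoch_plus n :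
  qpoch_plus n * theta n =
    \sum_(s < n.+1) (\prod_(j < s) - (1 + 'X^j)) *
       (\prod_(s <= j < n) (1 - 'X^(j.+1))) * 'X^(s * n.+1).
Proof.
pose a s : poly := \prod_(j < s) - (1 + 'X^j).
pose Q s n : poly := \prod_(s <= j < n) (1 - 'X^(j.+1)).
have aS s : a s.+1 = - (a s * (1 + 'X^s)) by rewrite /a big_ord_recr /= mulrN.
have QS s m : (s <= m)%N -> Q s m.+1 = Q s m * (1 - 'X^(m.+1)).
  by move=> le; rewrite /Q big_nat_recr.
have Qn s : Q s s = 1 by rewrite /Q big_geq.
have QSl s m : (s < m)%N -> Q s m = (1 - 'X^(s.+1)) * Q s.+1 m.
  by move=> lt; rewrite /Q big_ltn.
(* The factor [j = 0] of [a] is [-(1 + 1)]: this is where the 2 of [theta] comes from. *)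
have aE m : a m.+1 = (-1) ^+ m.+1 * qpoch_plus m *+ 2.
  elim: m => [|m IH].
    rewrite /a /qpoch_plus big_ord_recr !big_ord0 /= expr0 ; ring.
  by rewrite aS IH /qpoch_plus big_ord_recr /= [in RHS]exprS; ring.
elim: n => [|n IH].
  by rewrite /qpoch_plus /theta !big_ord0 big_ord_recr !big_ord0 /= big_geq // expr0; ring.
rewrite -!/(a _) in IH *.
have thetaS : theta n.+1 = theta n + (-1) ^+ n.+1 * 'X^(n.+1 ^ 2) *+ 2.
  by rewrite /theta big_ord_recr /= addrA.
have ES : qpoch_plus n.+1 = qpoch_plus n * (1 + 'X^(n.+1)).
  by rewrite /qpoch_plus big_ord_recr.
rewrite big_ord_recr /= -/(a _) -/(Q _ _) Qn.
(* Partial sums at level [n.+1] are [1 + 'X^(n.+1)] times those at level [n], up to one boundary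
   term, which is [a m.+1 * Q m n * 'X^(m.+1 * n.+1)]. *)
have telescope m : (m <= n)%N ->
   \sum_(s < m.+1) (a s * Q s n.+1 * 'X^(s * n.+2)) =
   (1 + 'X^(n.+1)) * (\sum_(s < m.+1) (a s * Q s n * 'X^(s * n.+1)))
   - a m * Q m n * (1 + 'X^m) * 'X^(m.+1 * n.+1).
  elim: m => [|m IHm] le.
    rewrite !big_ord_recr !big_ord0 /= QS // !mul0n mul1n expr0; ring.
  rewrite big_ord_recr [in RHS]big_ord_recr /= IHm 1?ltnW // QS // QSl // aS.
  by rewrite !mulSn !mulnS !exprD !exprS; ring.
rewrite telescope // thetaS ES.
(* The new term of [theta] contributes [- a n.+2 * 'X^(n.+1 ^ 2)]; on the other side the boundary
   term at [m = n] and the summand [s = n.+1] add up to the same. *)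
transitivity ((1 + 'X^(n.+1)) * (qpoch_plus n * theta n) +
   (- a n.+2 * 'X^(n.+1 ^ 2))).
  by rewrite aE ES [(-1) ^+ n.+2]exprS; ring.
rewrite IH -addrA; congr (_ + _); rewrite Qn !aS.
rewrite expnS expn1 [(n.+1 * n.+2)%N]mulnS exprD; ring.
Qed.

Lemma gauss_square n : eqmodX n.+1 (qpoch_plus n * theta n) (qpoch n).
Proof.
rewrite theta_mul_qpoch_plus big_ord_recl /= big_ord0 mul0n expr0 mul1r mulr1.
rewrite big_mkord -/(qpoch n).
exists (\sum_(s < n) (\prod_(j < s.+1) - (1 + 'X^j)) *
       (\prod_(s.+1 <= j < n) (1 - 'X^(j.+1))) * 'X^(s * n.+1)).
rewrite addrC addKr mulr_suml; apply: eq_bigr => s _.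
by rewrite -!mulrA -exprD addnC -mulSn.
Qed.

End Gauss.

(** * Sums over tuples *)

Section TupleSums.
Context {R : comNzRingType}.

Lemma sum_tuple0 (V : nmodType) (T : finType) (F : 0.-tuple T -> V) :
  \sum_t F t = F [tuple].
Proof. by apply: big_pred1 => t; apply/esym/eqP/tuple0. Qed.

Lemma sum_tuple_cons (V : nmodType) (T : finType) k (F : k.+1.-tuple T -> V) :
  \sum_t F t = \sum_x \sum_(t : k.-tuple T) F [tuple of x :: t].
Proof.
rewrite pair_bigA /=.
apply: (reindex (fun p : T * k.-tuple T => [tuple of p.1 :: p.2])).
apply: onW_bij; exists (fun t => (thead t, [tuple of behead t])) => [[x t]|t].
  by rewrite theadE; congr (_, _); apply: val_inj.
by rewrite /= -tuple_eta.
Qed.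

Lemma sum_tuple_prod (T : finType) k (f : T -> R) :
  \sum_(t : k.-tuple T) \prod_(x <- t) f x = (\sum_x f x) ^+ k.
Proof.
elim: k => [|k IH].
  by rewrite sum_tuple0 expr0 big_nil.
rewrite sum_tuple_cons exprS -IH mulr_suml; apply: eq_bigr => x _.
by rewrite mulr_sumr; apply: eq_bigr => t _; rewrite /= big_cons.
Qed.

End TupleSums.

(* Overpartitions are the sequences sorted for this transitive relation between
   consecutive entries: a repeated part is not overlined. *)
Definition overpart_rel : rel (nat * bool) :=
  fun x y => (y.1 < x.1)%N || (y.1 == x.1) && ~~ y.2.

Lemma overpart_rel_trans : transitive overpart_rel.
Proof.
move=> [a b] [c d] [e f]; rewrite /overpart_rel /= => H1 H2.
apply/orP; case/orP: H1 => [lt1|/andP[/eqP e1 nb]];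
  case/orP: H2 => [lt2|/andP[/eqP e2 nf]].
- by left; apply: ltn_trans lt2 lt1.
- by left; rewrite e2.
- by left; rewrite -e1.
- by right; rewrite e2 e1 eqxx nf.
Qed.

(** In a nonincreasing sequence equal parts are contiguous, so being a first occurrence can be
    tested against the preceding entry alone. *)
Lemma is_overpartitionE n s :
  is_overpartition n s =
  [&& all (fun x => 0 < x.1)%N s, sorted overpart_rel s & sumn (map fst s) == n].
Proof.
rewrite /is_overpartition; congr (_ && _).
rewrite andbCA [RHS]andbC; congr (_ && _).
pose x0 := (0%N, false).
have nthE i : (i < size s)%N -> nth 0%N (map fst s) i = (nth x0 s i).1.
  by move=> lt; rewrite (nth_map x0).
rewrite -[(0%N, false)]/x0.
apply/andP/idP => [[ge_s /allP first_s]|sort_s].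
  apply/(sortedP x0) => i lt_i.
  move/(sortedP 0%N): ge_s => /(_ i); rewrite size_map !nthE ?(ltnW lt_i) //.
  move=> /(_ lt_i); rewrite /= /overpart_rel leq_eqVlt orbC => /orP[-> //|].
  move=> /eqP eq_i; rewrite eq_i eqxx /=; apply/orP; right; apply/negP => ov.
  have := first_s i.+1; rewrite mem_iota /= lt_i ov => /(_ isT) /eqP idx.
  have := @index_nth _ 0%N i (map fst s); rewrite size_map (ltnW lt_i).
  by rewrite nthE ?(ltnW lt_i) // -eq_i idx ltnn => /(_ isT).
split.
  rewrite sorted_map; apply: sub_sorted sort_s => x y.
  by rewrite /overpart_rel /= => /orP[/ltnW //|/andP[/eqP -> _]].
apply/allP => i; rewrite mem_iota /= add0n => lt_i; apply/implyP => ov.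
have le_idx : (index (nth x0 s i).1 (map fst s) <= i)%N.
  by rewrite -nthE // index_nth // size_map.
(* By transitivity an earlier entry is related to the overlined entry [i], so its part is strictly
   larger, not equal. *)
rewrite eqn_leq le_idx leqNgt; apply/negP => lt_idx.
have lt_size := ltn_trans lt_idx lt_i.
have := sorted_ltn_nth overpart_rel_trans x0 sort_s _ _ lt_size lt_i lt_idx.
rewrite /overpart_rel ov andbF orbF -(nthE _ lt_size) nth_index ?ltnn //.
by rewrite -nthE // mem_nth // size_map.
Qed.

(** * The generating series of overpartitions *)

Section OverpartitionSeries.
Context {R : comNzRingType}.
Local Notation poly := {poly R}.

(* Weight 0 discards the sequences with a zero part. *)
Definition part_weight a : poly := if (0 < a)%N then 'X^a else 0.

Lemma prod_part_weight (s : seq nat) :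
  \prod_(a <- s) part_weight a =
    if all (fun a => 0 < a)%N s then 'X^(sumn s) else 0.
Proof.
elim: s => [|a s IH]; first by rewrite big_nil expr0.
rewrite big_cons IH /part_weight /=; case: (0 < a)%N; last by rewrite mul0r.
by case: ifP => _ /=; rewrite ?mulr0 ?exprD.
Qed.

(* Generating polynomial of the sequences of k entries that may follow an entry
   with part m: parts are at most m, and parts equal to m are not overlined. *)
Fixpoint overpart_poly k m : poly :=
  if k is k'.+1 then
    \sum_(a < m) part_weight a * overpart_poly k' a *+ 2
      + part_weight m * overpart_poly k' m
  else 1.

Definition overpart_val N (x : 'I_N.+1 * bool) : nat * bool := (val x.1, x.2).

(** Splits off the first entry, subject to a test [P]. Its overline changes neither its weight nor
    the sum over its continuations, hence the multiplicity [P a true + P a false]. *)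
Lemma sum_overpart_step N k (P : nat -> bool -> bool) :
  (forall x : 'I_N.+1 * bool,
    \sum_(t : k.-tuple ('I_N.+1 * bool))
       (if path overpart_rel (overpart_val x) (map (@overpart_val N) t)
        then \prod_(y <- t) part_weight y.1 else 0) = overpart_poly k x.1) ->
  \sum_(t : k.+1.-tuple ('I_N.+1 * bool))
       (if (if map (@overpart_val N) t is x :: s
            then P x.1 x.2 && path overpart_rel x s else true)
        then \prod_(y <- t) part_weight y.1 else 0) =
  \sum_(a < N.+1) (part_weight a * overpart_poly k a) *+ (P a true + P a false).
Proof.
move=> H; rewrite sum_tuple_cons.
transitivity (\sum_(x : 'I_N.+1 * bool)
    (part_weight x.1 * overpart_poly k x.1) *+ P x.1 x.2).
  apply: eq_bigr => x _; case Px: (P x.1 x.2); last first.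
    by rewrite big1 // => t _; rewrite /= Px.
  rewrite -H mulr_sumr mulr1n; apply: eq_bigr => t _; rewrite /= Px /=.
  by case: ifP => _; rewrite ?mulr0 // big_cons.
rewrite -(pair_bigA _ (fun (a : 'I_N.+1) (b : bool) => part_weight a * overpart_poly k a *+ P a b)) /=.
by apply: eq_bigr => a _; rewrite big_bool /= mulrnDr.
Qed.

Lemma sum_overpart_path N k m b : (m <= N)%N ->
  \sum_(t : k.-tuple ('I_N.+1 * bool))
     (if path overpart_rel (m, b) (map (@overpart_val N) t)
      then \prod_(y <- t) part_weight y.1 else 0) = overpart_poly k m.
Proof.
elim: k m b => [|k IH] m b le_mN.
  by rewrite sum_tuple0 big_nil.
(* The multiplicity is 2 for [a < m], 1 for [a = m] and 0 above. *)
transitivity (\sum_(a < N.+1) (part_weight a * overpart_poly k a) *+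
    (overpart_rel (m, b) (val a, true) + overpart_rel (m, b) (val a, false))).
  rewrite -(@sum_overpart_step N k (fun a c => overpart_rel (m, b) (a, c))).
    by apply: eq_bigr => t _; case: (map _ _).
  by move=> [a c]; rewrite IH //= -ltnS.
rewrite /= (big_ord_widen N.+1 (fun a => part_weight a * overpart_poly k a *+ 2)) ?leqW //.
have -> : part_weight m * overpart_poly k m =
  \sum_(i < N.+1 | i == m :> nat) part_weight i * overpart_poly k i.
  by rewrite (big_pred1 (Ordinal (le_mN : (m < N.+1)%N))).
rewrite [X in _ = X + _]big_mkcond [X in _ = _ + X]big_mkcond -big_split; apply: eq_bigr => a _ /=.
rewrite /overpart_rel /=; case: ltngtP => _ /=; rewrite ?andbF ?addr0 ?add0r //.
Qed.

Definition overpart_series N : poly :=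
  \sum_(k < N.+1) \sum_(t : k.-tuple ('I_N.+1 * bool))
     (if sorted overpart_rel (map (@overpart_val N) t)
      then \prod_(y <- t) part_weight y.1 else 0).

(** Raising the bound from [m] to [m.+1] lets the first entry be an overlined [m] or a plain
    [m.+1]. *)
Lemma overpart_polyS k m :
  overpart_poly k.+1 m.+1 = overpart_poly k.+1 m
    + part_weight m * overpart_poly k m
    + part_weight m.+1 * overpart_poly k m.+1.
Proof. rewrite /= big_ord_recr /=; ring. Qed.

Lemma part_weight_dvdX a : exists r, part_weight a = r * 'X.
Proof.
case: a => [|a]; first by exists 0; rewrite mul0r.
by exists 'X^a; rewrite -exprSr.
Qed.

Lemma overpart_poly_dvdX k m : exists r, overpart_poly k m = r * 'X^k.
Proof.
elim: k m => [|k IH] m; first by exists 1; rewrite mul1r expr0.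
have step a : exists r, part_weight a * overpart_poly k a = r * 'X^(k.+1).
  have [u ->] := part_weight_dvdX a; have [v ->] := IH a.
  by exists (u * v); rewrite exprS; ring.
elim: m => [|m [r IHm]].
  by rewrite /= big_ord0 add0r.
have [u eu] := step m; have [v ev] := step m.+1.
by exists (r + u + v); rewrite overpart_polyS IHm eu ev; ring.
Qed.

(** A sequence of [N.+1] positive parts has sum above [N], so bounding the length loses nothing
    modulo ['X^(N.+1)]. *)
Lemma part_weight_mul_overpart_poly N a :
  eqmodX N.+1 (part_weight a * overpart_poly N a) 0.
Proof.
have [u ->] := part_weight_dvdX a; have [v ->] := overpart_poly_dvdX N a.
by exists (u * v); rewrite exprS; ring.
Qed.

Definition overpart_psum N m := \sum_(k < N) overpart_poly k m.

(** Summing [overpart_polyS] over the lengths gives this relation, except that the shortened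
    sequences miss the top length; those terms vanish modulo ['X^(N.+1)]. *)
Lemma overpart_psumS N m : eqmodX N.+1
  ((1 - part_weight m.+1) * overpart_psum N.+1 m.+1)
  ((1 + part_weight m) * overpart_psum N.+1 m).
Proof.
have [u eu] := part_weight_mul_overpart_poly N m.
have [v ev] := part_weight_mul_overpart_poly N m.+1.
rewrite !subr0 in eu ev.
exists (- u - v).
have -> : (- u - v) * 'X^(N.+1) = - (u * 'X^(N.+1)) - v * 'X^(N.+1) by ring.
rewrite -eu -ev.
have split_last j : overpart_psum N.+1 j = overpart_psum N j + overpart_poly N j.
  by rewrite /overpart_psum big_ord_recr.
have split_first : overpart_psum N.+1 m.+1 = overpart_psum N.+1 m
   + part_weight m * overpart_psum N m + part_weight m.+1 * overpart_psum N m.+1.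
  rewrite /overpart_psum !mulr_sumr big_ord_recl [in RHS]big_ord_recl -!addrA.
  congr (_ + _); rewrite -!big_split; apply: eq_bigr => k _.
  by rewrite overpart_polyS /=; ring.
rewrite [(1 - _) * _]mulrDl mul1r {1}split_first !split_last; ring.
Qed.

(** The product on the right stops before [m] because a part [m] cannot be overlined after an entry
    [m]; its factor [j = 0] is 1. *)
Lemma qpoch_mul_overpart_psum N m : eqmodX N.+1
  (qpoch m * overpart_psum N.+1 m) (\prod_(j < m) (1 + part_weight j)).
Proof.
elim: m => [|m IH].
  rewrite /qpoch !big_ord0 mul1r /overpart_psum big_ord_recl big1 ?addr0.
    exact: eqmodX_refl.
  by move=> k _; rewrite /= big_ord0 mul0r addr0.
rewrite /qpoch !big_ord_recr /= -/(qpoch m) -mulrA.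
apply: eqmodX_trans (eqmodXM (eqmodX_refl _ _) (overpart_psumS N m)) _.
rewrite mulrCA mulrC; exact: eqmodXM IH (eqmodX_refl _ _).
Qed.

(** The first summand treats the sequence as following an entry [N]; the second adds the sequences
    that start with an overlined [N]. *)
Lemma overpart_seriesE N :
  overpart_series N =
    overpart_psum N.+1 N + part_weight N * overpart_psum N N.
Proof.
rewrite /overpart_series /overpart_psum !big_ord_recl /=.
rewrite mulr_sumr -addrA -big_split; congr (_ + _).
  by rewrite sum_tuple0 big_nil.
apply: eq_bigr => k _; rewrite /bump /= add1n.
transitivity (\sum_(a < N.+1) (part_weight a * overpart_poly k a) *+ 2).
  rewrite -(@sum_overpart_step N k (fun _ _ => true)).
    by apply: eq_bigr => t _; case: (map _ _).
  by move=> [a b]; rewrite sum_overpart_path //= -ltnS.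
by rewrite add0n big_ord_recr /=; ring.
Qed.

Lemma qpoch_mul_overpart_series N :
  eqmodX N.+1 (qpoch N * overpart_series N) (qpoch_plus N).
Proof.
(* The last factor will be supplied by the sequences starting with an overlined [N]. *)
have -> : qpoch_plus N = \prod_(j < N) (1 + part_weight j) * (1 + part_weight N).
  transitivity (\prod_(j < N.+1) (1 + part_weight j)); last by rewrite big_ord_recr.
  by rewrite big_ord_recl addr0 mul1r.
apply: eqmodX_trans (eqmodXM (qpoch_mul_overpart_psum N N) (eqmodX_refl _ _)).
have [u eu] := part_weight_mul_overpart_poly N N; rewrite subr0 in eu.
exists (- qpoch N * u); rewrite -[RHS]mulrA -eu overpart_seriesE.
have -> : overpart_psum N.+1 N = overpart_psum N N + overpart_poly N N.
  by rewrite /overpart_psum big_ord_recr.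
ring.
Qed.

Lemma overpartition_countE N :
  (overpartition_count N)%:R = (overpart_series N)`_N.
Proof.
rewrite /overpart_series coef_sum natr_sum; apply: eq_bigr => k _.
rewrite coef_sum -sum1_card natr_sum big_mkcond; apply: eq_bigr => t _.
have -> : \prod_(y <- t) part_weight y.1 =
    \prod_(a <- map fst (map (@overpart_val N) t)) part_weight a.
  by rewrite !big_map.
rewrite inE -[map (fun x => _) t]/(map (@overpart_val N) t) is_overpartitionE.
rewrite prod_part_weight [all _ (map fst _)]all_map.
rewrite -[all _ _ in RHS]/(all (fun x => 0 < x.1)%N (map (@overpart_val N) t)).
case: (all _ _) => /=; last by case: ifP => _; rewrite coef0.
case: (sorted _ _) => /=; last by rewrite coef0.
by rewrite coefXn eq_sym; case: eqP.
Qed.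

End OverpartitionSeries.

(** * Compositions into squares and the inverse of [theta] *)

Section SquareCompositions.
Context {R : comNzRingType}.
Local Notation poly := {poly R}.

(** The sign [(-1) ^+ a] is multiplicative over the parts, so every composition of [n] gets the same
    sign [(-1) ^+ n]. *)
Definition square_series N : poly :=
  \sum_(a < N.+1) (if is_pos_square a then (-1) ^+ a * 'X^a else 0).

Definition sq_composition_series N : poly :=
  \sum_(k < N.+1) (- 2 * square_series N) ^+ k.

Lemma prod_square_weight (s : seq nat) :
  \prod_(a <- s) (if is_pos_square a then (-1) ^+ a * 'X^a else 0 : poly) =
    if all is_pos_square s then (-1) ^+ sumn s * 'X^(sumn s) else 0.
Proof.
elim: s => [|a s IH]; first by rewrite big_nil !expr0 mulr1.
rewrite big_cons IH /=; case: (is_pos_square a); last by rewrite mul0r.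
by case: ifP => _ /=; rewrite ?mulr0 // !exprD mulrACA.
Qed.

Lemma coef_sq_composition_series N :
  (sq_composition_series N)`_N =
    (-1) ^+ N * \sum_(k < N.+1)
      \sum_(t : k.-tuple 'I_N.+1 | is_sq_composition N (map val t)) (-2) ^+ k.
Proof.
rewrite /sq_composition_series coef_sum [RHS]mulr_sumr; apply: eq_bigr => k _.
rewrite exprMn -sum_tuple_prod mulr_sumr coef_sum mulr_sumr [RHS]big_mkcond.
apply: eq_bigr => t _.
rewrite -(big_map val xpredT (fun a => if is_pos_square a then (-1) ^+ a * 'X^a else 0)).
rewrite prod_square_weight /is_sq_composition.
have -> : (- 2 : poly) ^+ k = ((-2) ^+ k)%:P by rewrite polyC_exp polyCN polyC_natr.
case: (all _ _) => /=; last by rewrite mulr0 coef0.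
have -> m : (-1 : poly) ^+ m = ((-1) ^+ m)%:P by rewrite polyC_exp polyCN polyC1.
rewrite !coefCM coefXn eq_sym; case: eqP => [->|_]; last by rewrite !mulr0.
by rewrite mulr1 mulrC.
Qed.

(** One side lists squares by their root, the other by their value; squares above [N] disappear
    modulo ['X^(N.+1)]. *)
Lemma theta_square_series N : eqmodX N.+1 (theta N) (1 + 2 * square_series N).
Proof.
have -> : theta N = 1 + 2 * \sum_(j < N) (-1) ^+ j.+1 * 'X^(j.+1 ^ 2) :> poly.
  by rewrite /theta mulr_sumr; congr (_ + _); apply: eq_bigr => j _; ring.
have [r er] : eqmodX N.+1 (\sum_(j < N) (-1) ^+ j.+1 * 'X^(j.+1 ^ 2)) (square_series N).
  apply/eqmodXP => i lt_iN.
  have sgnE m : (-1 : poly) ^+ m = ((-1) ^+ m)%:P.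
    by rewrite polyC_exp polyCN polyC1.
  have -> : (square_series N)`_i = if is_pos_square i then (-1) ^+ i else 0.
    rewrite coef_sum (bigD1 (Ordinal lt_iN)) //= big1 => [|a ne_ai].
      by case: ifP => _; rewrite ?coef0 ?addr0 // sgnE coefCM coefXn eqxx mulr1.
    have ne : i == a = false.
      by apply: contraNF ne_ai => /eqP e; apply/eqP/val_inj.
    by case: ifP => _; rewrite ?coef0 // sgnE coefCM coefXn ne mulr0.
  rewrite coef_sum.
  under eq_bigr => j _ do rewrite sgnE coefCM coefXn.
  case: ifP => [/andP[i_gt0 /existsP[[j lt_j] /= /eqP ej]]|not_sq].
    case: j lt_j ej => [|j] lt_j ej; first by rewrite -ej in i_gt0.
    have lt_jN : (j < N)%N by nia.
    rewrite (bigD1 (Ordinal lt_jN)) //= big1 => [|l ne_lj].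
      (* The signs agree because a number and its square have the same parity. *)
      by rewrite -mulnn ej eqxx mulr1 addr0 -[RHS]signr_odd -ej oddM andbb signr_odd.
    rewrite (_ : i == _ = false) ?mulr0 //; apply: contraNF ne_lj => /eqP e.
    by apply/eqP/val_inj => /=; nia.
  rewrite big1 // => j _; case: eqP => [e|]; last by rewrite mulr0.
  case/negP: (negbT not_sq); rewrite e /is_pos_square expn_gt0 /=.
  have lt_j : (j.+1 < (j.+1 ^ 2).+1)%N by nia.
  by apply/existsP; exists (Ordinal lt_j); rewrite /= mulnn.
exists (2 * r); rewrite -[RHS]mulrA -er; ring.
Qed.

Lemma theta_mul_sq_composition_series N :
  eqmodX N.+1 (theta N * sq_composition_series N) 1.
Proof.
apply: eqmodX_trans (eqmodXM (theta_square_series N) (eqmodX_refl _ _)) _.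
(* The squares are positive, so there is no constant term and one factor [X] can be taken out. *)
have [g eg] : exists g, - 2 * square_series N = 'X * g.
  exists (- 2 * \sum_(a < N.+1) (if is_pos_square a then (-1) ^+ a * 'X^(a.-1) else 0)).
  rewrite mulrCA; congr (_ * _); rewrite mulr_sumr; apply: eq_bigr => a _.
  case: ifP => [/andP[a_gt0 _]|]; last by rewrite mulr0.
  by rewrite -{2}(prednK a_gt0) exprS mulrCA.
have -> : 1 + 2 * square_series N = 1 - 'X * g by rewrite -eg; ring.
rewrite /sq_composition_series eg; exact: eqmodX_geometric.
Qed.

Lemma qpoch_plus_coef0 N : (qpoch_plus N : poly)`_0 = 1.
Proof.
rewrite -horner_coef0 horner_prod big1 // => j _.
by rewrite !hornerE expr0n addr0.
Qed.

Lemma overpart_series_sq_composition_series N :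
  eqmodX N.+1 (overpart_series N : poly) (sq_composition_series N).
Proof.
have E0 := qpoch_plus_coef0 N; have refl := @eqmodX_refl R N.+1.
have inv := theta_mul_sq_composition_series N.
apply: (eqmodX_cancel E0).
have ET : eqmodX N.+1 (qpoch_plus N * theta N * overpart_series N) (qpoch_plus N : poly).
  apply: eqmodX_trans (qpoch_mul_overpart_series N).
  exact: eqmodXM (gauss_square N) (refl _).
apply: eqmodX_trans (eqmodXM ET (refl (sq_composition_series N))).
rewrite -[X in eqmodX _ X _]mulr1.
have -> : qpoch_plus N * theta N * overpart_series N * sq_composition_series N =
  qpoch_plus N * overpart_series N * (theta N * sq_composition_series N) :> poly by ring.
exact: eqmodXM (refl _) (eqmodX_sym inv).
Qed.

End SquareCompositions.

(* Compositions of n have length k <= n and parts <= n, so they are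
   enumerated as k-tuples of 'I_n.+1, k < n.+1. *)
Theorem theorem3 (n : nat) :
  (overpartition_count n)%:Z =
    (-1) ^+ n * \sum_(k < n.+1)
      \sum_(t : k.-tuple 'I_n.+1 | is_sq_composition n (map val t))
        (-2 : int) ^+ k.
Proof.
rewrite -coef_sq_composition_series -natz overpartition_countE.
by have /eqmodXP := @overpart_series_sq_composition_series int n; apply.
Qed.
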